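(* Let $D$ be a simple strongly connected digraph on $n\geq 2$ vertices. Then $2\leq q(D)\leq 2(n-1)$; moreover $q(D)=2n-2$ if and only if $D\cong\overset{\longleftrightarrow}{K_n}$, and $q(D)=2$ if and only if $D\cong\overrightarrow{C_n}$.
   Context: Digraphs are finite and simple (no loops, no multiple arcs; opposite arcs allowed). $q(D)$ is the spectral radius of the signless Laplacian matrix $Q(D)=\mathrm{diag}(d_1^+,\ldots,d_n^+)+A(D)$, where $d_i^+$ is the outdegree of vertex $i$ and $A(D)$ is the adjacency matrix. $\overset{\longleftrightarrow}{K_n}$ is the complete digraph on $n$ vertices (all arcs $(i,j)$, $i\neq j$) and $\overrightarrow{C_n}$ is the directed cycle on $n$ vertices. *)

(* Defs.v *)
From HB Require Import structures.
From mathcomp Require Import all_boot all_order all_algebra.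
From mathcomp Require Import complex.
From mathcomp Require Import boolp classical_sets reals.

Set Implicit Arguments.
Unset Strict Implicit.
Unset Printing Implicit Defensive.

Import Order.TTheory GRing.Theory Num.Theory.
Local Open Scope ring_scope.

(* An arc set is a relation, so multiple arcs are excluded by construction. *)
Record digraph := Digraph {
  vertex :> finType;
  arc : rel vertex;
  arc_irr : irreflexive arc
}.

Arguments arc {d} x y.

Definition strongly_connected (D : digraph) : Prop :=
  forall x y : D, connect (@arc D) x y.

Definition digraph_iso (D1 D2 : digraph) : Prop :=
  exists f : D1 -> D2, bijective f /\ forall x y, arc (f x) (f y) = arc x y.

Lemma complete_arc_irr n : irreflexive (fun x y : 'I_n => x != y).
Proof. by move=> x; rewrite eqxx. Qed.

Definition complete_digraph (n : nat) : digraph :=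
  Digraph (@complete_arc_irr n).

(* [ordS x] is [x + 1] modulo [n].  The conjunct [x != y] only matters for
   [n = 1], where it removes the loop; it is redundant for [n >= 2]. *)
Lemma dicycle_arc_irr n :
  irreflexive (fun x y : 'I_n => (x != y) && (y == ordS x)).
Proof. by move=> x; rewrite eqxx. Qed.

Definition dicycle (n : nat) : digraph := Digraph (@dicycle_arc_irr n).

Definition outdeg (D : digraph) (x : D) : nat := #|[set y : D | arc x y]|.

(* Rows and columns follow the enumeration [enum_val] of the vertices; another
   enumeration would conjugate the matrices by a permutation matrix. *)
Definition adjacency (F : nzRingType) (D : digraph) : 'M[F]_#|D| :=
  \matrix_(i, j) (arc (enum_val i) (enum_val j))%:R.

Definition outdeg_mx (F : nzRingType) (D : digraph) : 'M[F]_#|D| :=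
  diag_mx (\row_i (outdeg (enum_val i))%:R).

Definition signless_laplacian (F : nzRingType) (D : digraph) : 'M[F]_#|D| :=
  outdeg_mx F D + adjacency F D.

(* The largest modulus of a complex eigenvalue: for [n > 0] the set below is
   finite and nonempty, so its supremum is its maximum. *)
Definition spectral_radius (R : realType) (n : nat) (A : 'M[R[i]]_n) : R :=
  sup [set Normc.normc z | z in [set z : R[i] | eigenvalue A z]]%classic.

Definition q (R : realType) (D : digraph) : R :=
  spectral_radius (signless_laplacian R[i] D).

(* Main.v *)
(** Perron-Frobenius by the Collatz-Wielandt argument.  Among the pairs [(v, c)]
    with [v >= 0], [sum v = 1], [c >= 0] and [c v <= v A], which form a compact
    set, take one with [c] maximal.  If [v A <> c v], applying [(1 + A)^m],
    which is entrywise positive by irreducibility, turns [c v <= v A] into a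
    strict inequality, so [c] could be increased; hence [v A = c v] and [v > 0].
    For a complex eigenvector [u] of eigenvalue [z], the vector [|u|] satisfies
    [|z| |u| <= |u| A], so [|z| <= c]: the spectral radius is [c].  For the
    signless Laplacian, summing the entries of [v Q = q v] shows that [q / 2] is
    an average of the outdegrees with positive weights.  As outdegrees lie
    between [1] and [n - 1], both bounds follow, and equality forces all
    outdegrees to be [1], resp. [n - 1]. *)
Require Import Defs.
From mathcomp Require Import all_boot all_order all_algebra.
From mathcomp Require Import reals.
From mathcomp Require Import complex boolp classical_sets topology normedtype.
From mathcomp Require Import derive.

Set Implicit Arguments.
Unset Strict Implicit.
Unset Printing Implicit Defensive.

Import Order.TTheory GRing.Theory Num.Theory.
Import numFieldNormedType.Exports.
(* [path] also defines an [arc]. *)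
Import Defs.

Local Open Scope ring_scope.

(** * Perron vectors of irreducible nonnegative matrices *)

Definition irreducible_mx (R : nmodType) m (A : 'M[R]_m) : Prop :=
  forall i j, connect (fun i j => A i j != 0) i j.

Section Perron.
Variables (R : realType) (m : nat) (A : 'M[R]_m).
Hypothesis A_ge0 : forall i j, 0 <= A i j.

(** Multiplication by [1 + A]. The summand [x] keeps positive entries positive, so [m] steps cover
    every path with at most [m] edges. *)
Let step (x : 'rV[R]_m) := x + x *m A.

Lemma mulmx_nonneg (x : 'rV[R]_m) :
  (forall j, 0 <= x 0 j) -> forall j, 0 <= (x *m A) 0 j.
Proof. by move=> x0 j; rewrite mxE sumr_ge0 // => i _; rewrite mulr_ge0. Qed.

Lemma iter_step_ge (x : 'rV[R]_m) k :
  (forall j, 0 <= x 0 j) -> forall j, x 0 j <= iter k step x 0 j.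
Proof.
move=> x0; elim: k => //= k IHk j; apply: (le_trans (IHk j)).
rewrite /step mxE lerDl; apply: mulmx_nonneg => i.
exact: le_trans (IHk i).
Qed.

Lemma iter_step_path (x : 'rV[R]_m) i p :
  (forall j, 0 <= x 0 j) -> 0 < x 0 i -> path (fun i j => A i j != 0) i p ->
  0 < iter (size p) step x 0 (last i p).
Proof.
elim: p i x => //= j p IHp i x x0 xi /andP[Aij pp].
rewrite -[step _]/(iter (size p).+1 step x) iterSr; apply: IHp => // [k|].
  by rewrite mxE addr_ge0 // mulmx_nonneg.
rewrite mxE ltr_wpDl // mxE (bigD1 i) //= ltr_pwDl //.
  by rewrite mulr_gt0 // lt_def Aij A_ge0.
by rewrite sumr_ge0 // => k _; rewrite mulr_ge0.
Qed.

Hypothesis A_irr : irreducible_mx A.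

Lemma iter_step_gt0 (x : 'rV[R]_m) :
  (forall j, 0 <= x 0 j) -> x != 0 -> forall j, 0 < iter m step x 0 j.
Proof.
move=> x0 /rV0Pn[i xi] j.
have /connectP[p pp ->] := A_irr i j.
case: (shortenP pp) => p' pp' up' _.
have sp : (size p' <= m)%N.
  rewrite -[leqRHS]card_ord (leq_trans (leqnSn _)) //.
  by rewrite -[_.+1]/(size (i :: p')) -(card_uniqP up') max_card.
have xi_gt0 : 0 < x 0 i by rewrite lt_def xi x0.
(* The surplus steps come first: they do not decrease [x 0 i], and the remaining ones follow the
   path. *)
have -> : iter m step x = iter (size p') step (iter (m - size p') step x).
  by rewrite -iterD subnKC.
apply: iter_step_path => // [k|].
  exact: le_trans (iter_step_ge _ x0 k).
exact: lt_le_trans (iter_step_ge _ x0 i).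
Qed.

Lemma iter_step_mulmx k (x : 'rV[R]_m) :
  iter k step (x *m A) = iter k step x *m A.
Proof. by elim: k => //= k ->; rewrite /step mulmxDl. Qed.

Lemma iter_stepZ k c (x : 'rV[R]_m) :
  iter k step (c *: x) = c *: iter k step x.
Proof. by elim: k => //= k ->; rewrite /step scalerDr scalemxAl. Qed.

Lemma iter_stepB k (x y : 'rV[R]_m) :
  iter k step (x - y) = iter k step x - iter k step y.
Proof. by elim: k => //= k ->; rewrite /step mulmxBl opprD addrACA. Qed.

(** Keeping the factor as a coordinate, rather than as a minimum of quotients [(v A)_j / v_j], makes
    every condition closed, also where [v] vanishes. *)
Let admissible : set ('rV[R]_m * R) :=
  [set p : 'rV[R]_m * R |
    [/\ forall j, 0 <= p.1 0 j, \sum_j p.1 0 j = 1, 0 <= p.2 &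
        forall j, p.2 * p.1 0 j <= (p.1 *m A) 0 j]]%classic.

Let coord_cont j : continuous (fun p : 'rV[R]_m * R => p.1 0 j).
Proof.
move=> p; apply: (@continuous_comp _ _ _ fst (fun x : 'rV[R]_m => x 0 j)).
  exact: cvg_fst.
exact: coord_continuous.
Qed.

Let snd_cont : continuous (fun p : 'rV[R]_m * R => p.2).
Proof. by move=> p; exact: cvg_snd. Qed.

Lemma closed_admissible : closed admissible.
Proof.
have -> : admissible =
  ((\bigcap_j [set p : 'rV[R]_m * R | 0 <= p.1 0 j]) `&`
   [set p : 'rV[R]_m * R | \sum_j p.1 0 j = 1] `&`
   [set p : 'rV[R]_m * R | 0 <= p.2] `&`
   \bigcap_j [set p : 'rV[R]_m * R |
     0 <= (p.1 *m A) 0 j - p.2 * p.1 0 j])%classic.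
  apply/seteqP; split=> p /=.
    move=> [H1 H2 H3 H4]; split=> [|j _]; last by rewrite /= subr_ge0.
    by split=> //; split=> // j _; exact: H1.
  move=> [[[H1 H2] H3] H4]; split => // j; first exact: H1.
  by rewrite -subr_ge0; exact: H4.
have sum_cont (F : 'I_m -> 'rV[R]_m * R -> R) :
    (forall i, continuous (F i)) -> continuous (fun p => \sum_i F i p).
  by move=> cF; apply: continuous_big => //; exact: add_continuous.
apply: closedI; [apply: closedI; [apply: closedI|]|].
- apply: closed_bigI => j _; apply: preimage_closed (@closed_ge R 0) => p _.
  exact: coord_cont.
- apply: (@preimage_closed _ _ (fun p : 'rV[R]_m * R => \sum_j p.1 0 j)
    [set 1%R]%classic).
    by move=> p _; apply: sum_cont => j; exact: coord_cont.
  exact: closed_eq.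
- by apply: preimage_closed (@closed_ge R 0) => p _; exact: snd_cont.
- apply: closed_bigI => j _.
  apply: (@preimage_closed _ _
    (fun p : 'rV[R]_m * R => (p.1 *m A) 0 j - p.2 * p.1 0 j)
    [set x | 0 <= x]%classic _ (@closed_ge R 0)) => p _.
  apply: cvgB; last by apply: cvgM; [exact: snd_cont|exact: coord_cont].
  have -> : (fun p : 'rV[R]_m * R => (p.1 *m A) 0 j) =
            (fun p => \sum_i p.1 0 i * A i j).
    by apply/funext => x; rewrite mxE.
  rewrite mxE.
  apply: (sum_cont (fun i p => p.1 0 i * A i j)) => i x.
  by apply: cvgM; [exact: coord_cont|exact: cvg_cst].
Qed.

Lemma admissible_le v c j : admissible (v, c) -> 0 <= v 0 j <= 1.
Proof.
move=> [/= v0 v1 _ _]; rewrite v0 -v1 (bigD1 j) //= lerDl.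
by rewrite sumr_ge0.
Qed.

Lemma compact_admissible : compact admissible.
Proof.
(* Summing [c v_j <= (v A)_j] over [j] bounds [c] by the sum of all entries of [A], since [v] has
   sum 1 and entries at most 1. *)
pose B := \sum_j \sum_i A i j.
apply: (@subclosed_compact _ _
  ([set v : 'rV[R]_m | forall j, `[0, 1]%classic (v 0 j)] `*` `[0, B])%classic
  closed_admissible).
  apply: compact_setX; last exact: segment_compact.
  by apply: (@rV_compact R m (fun=> `[0, 1]%classic)) => j;
    exact: segment_compact.
move=> [v c] vc; have /= [v0 v1 c0 vA] := vc; split=> /=.
  by move=> j; rewrite /= in_itv /=; exact: (admissible_le _ vc).
rewrite in_itv /= c0 /= -[c]mulr1 -v1 mulr_sumr.
apply: ler_sum => j _; apply: (le_trans (vA j)); rewrite mxE.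
apply: ler_sum => i _; rewrite ler_piMl //.
by have /andP[] := admissible_le i vc.
Qed.

Lemma perron (i0 : 'I_m) : exists c (v : 'rV[R]_m),
  [/\ 0 <= c, forall j, 0 < v 0 j, v *m A = c *: v &
      forall c' (w : 'rV[R]_m), (forall j, 0 <= w 0 j) -> w != 0 ->
        (forall j, c' * w 0 j <= (w *m A) 0 j) -> c' <= c].
Proof.
have ne : (admissible !=set0)%classic.
  exists (delta_mx 0 i0, 0); split=> //= [j||j].
  - by rewrite mxE; case: (_ && _).
  - rewrite (bigD1 i0) //= mxE !eqxx big1 ?addr0 // => j /negPf ji0.
    by rewrite mxE eqxx ji0.
  - rewrite mul0r mulmx_nonneg // => k.
    by rewrite mxE; case: (_ && _).
have /= := compact_EVT_max ne compact_admissible.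
move=> /(_ _ snd).
case=> [|[v c] /= /set_mem vc maxc].
  by apply: continuous_subspaceT; exact: snd_cont.
(* Maximality extends to unnormalized [w] by rescaling, and to negative [c'] because [c >= 0]. *)
have {}maxc c' (w : 'rV[R]_m) : (forall j, 0 <= w 0 j) -> w != 0 ->
        (forall j, c' * w 0 j <= (w *m A) 0 j) -> c' <= c.
  move=> w0 wn0 wA; have [c'0|c'0] := ltP c' 0.
    by case: vc => /= _ _ c0 _; apply: le_trans c0; apply: ltW.
  have s0 : 0 < \sum_j w 0 j.
    have /rV0Pn[i wi] := wn0.
    rewrite (bigD1 i) //= ltr_pwDl ?sumr_ge0 //.
    by rewrite lt_def wi w0.
  apply: (maxc ((\sum_j w 0 j)^-1 *: w, c')); apply/mem_set; split=> //= [j||j].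
  - by rewrite mxE mulr_ge0 // invr_ge0 ltW.
  - under eq_bigr do rewrite mxE.
    by rewrite -mulr_sumr mulVf // gt_eqF.
  - by rewrite -scalemxAl !mxE mulrCA ler_pM2l ?invr_gt0 //; have := wA j;
    rewrite mxE.
have [/= v0 v1 c0 vA] := vc.
have vn0 : v != 0.
  apply/eqP => vE; move: v1; rewrite vE big1 => [/eqP|j _]; last by rewrite mxE.
  by rewrite eq_sym oner_eq0.
pose w := iter m step v.
have w_gt0 : forall j, 0 < w 0 j by exact: iter_step_gt0.
have vE : v *m A = c *: v.
  apply/eqP; rewrite -subr_eq0; apply/negPn/negP => y_n0.
  have y_gt0 : forall j, 0 < (w *m A - c *: w) 0 j.
    (* [(1 + A)^m] commutes with [A], so [w A - c w] is the image of the nonzero nonnegative vector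
       [v A - c v]. *)
    rewrite -iter_step_mulmx -iter_stepZ -iter_stepB.
    by apply: iter_step_gt0 => // j; rewrite mxE [X in _ + X]mxE subr_ge0 mxE.
  set y := w *m A - c *: w in y_gt0.
  (* The least quotient [y_j / w_j] is the largest amount by which [c] can grow while [w] still
     satisfies the inequality. *)
  pose j0 := [arg min_(j < i0) (y 0 j / w 0 j)]%O.
  have e_gt0 : 0 < y 0 j0 / w 0 j0 by rewrite divr_gt0.
  suff : c + y 0 j0 / w 0 j0 <= c by rewrite gerDl leNgt e_gt0.
  apply: (maxc _ w) => [j||j]; first exact: ltW.
    by apply/rV0Pn; exists i0; rewrite gt_eqF.
  rewrite mulrDl -lerBrDl.
  have -> : (w *m A) 0 j - c * w 0 j = y 0 j by rewrite !mxE.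
  rewrite -ler_pdivlMr // /j0; case: arg_minP => // k _; exact.
exists c, v; split=> // j.
(* Once [v A = c v], the vector [w] equals [(1 + c)^m v], so its positivity passes to [v]. *)
have iw k : iter k step v = (1 + c) ^+ k *: v.
  elim: k => [|k /= ->]; first by rewrite expr0 scale1r.
  by rewrite /step -scalemxAl vE exprS mulrC scalerA -scalerDl mulrDr mulr1.
have := w_gt0 j; rewrite /w iw mxE pmulr_rgt0 //.
by rewrite exprn_gt0 // ltr_pwDl.
Qed.
End Perron.

(** * The spectral radius as Perron eigenvalue *)

Section SpectralRadius.
Variables (R : realType) (m : nat) (A : 'M[R]_m).
Hypotheses (A_ge0 : forall i j, 0 <= A i j) (A_irr : irreducible_mx A).

(** Triangle inequality for [z u_j], the sum of the [u_i A_ij], where each [A_ij] is its own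
    modulus. *)
Lemma normc_mulmx_ge (z : R[i]) (u : 'rV[R[i]]_m) :
  u *m map_mx (real_complex R) A = z *: u ->
  forall j, Normc.normc z * Normc.normc (u 0 j) <=
    (map_mx (@Normc.normc R) u *m A) 0 j.
Proof.
move=> uA j; rewrite -Normc.normcM.
have -> : z * u 0 j = (u *m map_mx (real_complex R) A) 0 j by rewrite uA mxE.
have normE (w : R[i]) : (Normc.normc w)%:C%C = `|w| by [].
rewrite -lecR normE !mxE; apply: (le_trans (ler_norm_sum _ _ _)).
rewrite rmorph_sum /=; apply: ler_sum => i _.
rewrite !mxE normrM rmorphM /= ler_wpM2l //.
by rewrite normc_def /= expr0n addr0 sqrtr_sqr ger0_norm.
Qed.

Lemma spectral_radius_perron (i0 : 'I_m) : exists v : 'rV[R]_m,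
  (forall j, 0 < v 0 j) /\
  v *m A = spectral_radius (map_mx (real_complex R) A) *: v.
Proof.
have [c [v [c0 v0 vA maxc]]] := perron A_ge0 A_irr i0.
exists v; split=> //; rewrite vA /spectral_radius; congr (_ *: _).
set S := (X in sup X).
have ub_c : ubound S c.
  move=> _ [z /= /eigenvalueP[u uA un0] <-].
  apply: (maxc _ (map_mx (@Normc.normc R) u)) => [j||j].
  - by rewrite mxE; case: (u 0 j) => a b /=; exact: sqrtr_ge0.
  - have /rV0Pn[j uj] := un0; apply/rV0Pn; exists j; rewrite mxE.
    by apply: contra uj => /eqP/Normc.eq0_normc ->.
  - by rewrite [X in _ * X]mxE; exact: normc_mulmx_ge.
(* The bound is attained: read over the complex numbers, [v] is an eigenvector for [c]. *)
have Sc : S c.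
  exists (c%:C)%C; last by rewrite /= expr0n addr0 sqrtr_sqr ger0_norm.
  apply/eigenvalueP; exists (map_mx (real_complex R) v).
    by rewrite -map_mxM vA map_mxZ.
  apply/rV0Pn; exists i0; rewrite mxE.
  have := v0 i0; rewrite lt_def => /andP[+ _]; apply: contra => /eqP H.
  by apply/eqP; apply: (@complexI R).
apply: le_anti; rewrite ub_le_sup //=; last by exists c.
by rewrite ge_sup //; exists c.
Qed.

End SpectralRadius.

(** * The signless Laplacian and averages of outdegrees *)

Section SignlessLaplacian.
Variables (R : realType) (D : digraph).

Lemma signless_laplacian_map :
  signless_laplacian R[i] D = map_mx (real_complex R) (signless_laplacian R D).
Proof.
apply/matrixP => i j; rewrite !mxE rmorphD rmorphMn /= !rmorph_nat.
by [].
Qed.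

Lemma signless_laplacian_ge0 i j : 0 <= signless_laplacian R D i j.
Proof. by rewrite !mxE addr_ge0 // mulrn_wge0. Qed.

(** The diagonal entry and the arcs leaving the vertex each contribute the outdegree. *)
Lemma row_sum_signless_laplacian i :
  \sum_j signless_laplacian R D i j = 2 * (outdeg (enum_val i))%:R.
Proof.
under eq_bigr do rewrite !mxE.
rewrite big_split /= (bigD1 i) //= eqxx mulr1n big1 ?addr0; last first.
  by move=> j ji; rewrite eq_sym (negPf ji) mulr0n.
rewrite mulr_natl mulr2n; congr (_ + _).
rewrite -natr_sum.
rewrite -(big_enum_val (fun y : D => nat_of_bool (arc (enum_val i) y))) /=.
congr _%:R; rewrite /outdeg cardE -sum1_size big_enum_cond /=.
rewrite [RHS]big_mkcond /=; apply: eq_bigr => y _.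
by rewrite inE; case: arc.
Qed.

Hypothesis sc_D : strongly_connected D.

Lemma irreducible_signless_laplacian : irreducible_mx (signless_laplacian R D).
Proof.
move=> i j.
have /connectP[p] := sc_D (enum_val i) (enum_val j).
elim: p i => [|y p IHp] i /= => [_ /enum_val_inj -> //|/andP[xy py] jE].
apply: (@connect_trans _ _ (enum_rank y)); last first.
  by apply: IHp; rewrite enum_rankK.
apply: connect1; rewrite !mxE enum_rankK xy gt_eqF // ltr_wpDl //.
by rewrite mulrn_wge0.
Qed.

(** For a left eigenvector, summing the entries of [v Q = q v] brings in the row sums of [Q], which
    are twice the outdegrees; dividing by the sum of [v] normalizes the weights. *)
Lemma q_average_outdeg (x0 : D) : exists v : D -> R,
  [/\ forall x, 0 < v x, \sum_x v x = 1 &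
      q R D = 2 * \sum_x v x * (outdeg x)%:R].
Proof.
have [v [v0 vA]] := spectral_radius_perron signless_laplacian_ge0
  irreducible_signless_laplacian (enum_rank x0).
rewrite -signless_laplacian_map -/(q R D) in vA.
pose w x := v 0 (enum_rank x); pose s := \sum_x w x.
have w0 x : 0 < w x by exact: v0.
have s0 : 0 < s.
  by rewrite /s (bigD1 x0) //= ltr_pwDl // sumr_ge0 // => x _; exact: ltW.
have qs : q R D * s = 2 * \sum_x w x * (outdeg x)%:R.
  rewrite /s (big_enum_val w) (big_enum_val (fun x => w x * (outdeg x)%:R)) /=.
  rewrite !mulr_sumr /w.
  under eq_bigr => i _.
    rewrite enum_valK.
    have -> : q R D * v 0 i = (v *m signless_laplacian R D) 0 i.
      by rewrite vA mxE.
    rewrite mxE; over.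
  rewrite exchange_big; apply: eq_bigr => i _ /=.
  by rewrite -mulr_sumr row_sum_signless_laplacian enum_valK mulrCA.
exists (fun x => w x / s); split=> [x||].
- by rewrite divr_gt0.
- by rewrite -mulr_suml divff // gt_eqF.
- rewrite -[LHS](mulfK (lt0r_neq0 s0)) qs -mulrA mulr_suml.
  by congr (_ * _); apply: eq_bigr => x _; rewrite mulrAC.
Qed.

(** An average with positive weights of numbers at most [d] equals [d] only if all of them do;
    [?= iff] keeps the bound and its equality case together. The filter [| true] matches the form of
    [leif_sum]. *)
Lemma q_le (x0 : D) d : (forall x : D, outdeg x <= d)%N ->
  q R D <= 2 * d%:R ?= iff [forall (x : D | true), outdeg x == d].
Proof.
move=> le_d; have [v [v0 v1 ->]] := q_average_outdeg x0.
have dE : d%:R = \sum_x v x * d%:R by rewrite -mulr_suml v1 mul1r.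
rewrite (mono_leif (ler_pM2l _)) // dE; apply: leif_sum => x _.
by rewrite (mono_leif (ler_pM2l (v0 x))); split; rewrite ?ler_nat ?eqr_nat.
Qed.

Lemma q_ge (x0 : D) d : (forall x : D, d <= outdeg x)%N ->
  2 * d%:R <= q R D ?= iff [forall (x : D | true), outdeg x == d].
Proof.
move=> le_d; have [v [v0 v1 ->]] := q_average_outdeg x0.
have dE : d%:R = \sum_x v x * d%:R by rewrite -mulr_suml v1 mul1r.
rewrite (mono_leif (ler_pM2l _)) // dE; apply: leif_sum => x _.
rewrite (mono_leif (ler_pM2l (v0 x))).
by split; rewrite ?ler_nat // eqr_nat eq_sym.
Qed.

End SignlessLaplacian.

(** * Complete digraphs and directed cycles recognized by outdegrees *)

Lemma outdeg_iso (D1 D2 : digraph) (f : D1 -> D2) :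
  bijective f -> (forall x y, arc (f x) (f y) = arc x y) ->
  forall x, outdeg (f x) = outdeg x.
Proof.
move=> bf fa x; rewrite /outdeg -[RHS](card_imset _ (bij_inj bf)).
have [g fK gK] := bf; apply: eq_card => y; rewrite inE -[y]gK fa.
by rewrite (mem_imset _ _ (bij_inj bf)) inE.
Qed.

Lemma outdeg_leq_pred (D : digraph) (x : D) : (outdeg x <= #|D|.-1)%N.
Proof.
rewrite /outdeg -(cardC1 x) subset_leq_card //; apply/fintype.subsetP => y.
by rewrite !inE; apply: contraL => /eqP ->; rewrite arc_irr.
Qed.

(** A path from [x] to another vertex starts with an arc out of [x]. *)
Lemma outdeg_gt0 (D : digraph) (x : D) :
  strongly_connected D -> (1 < #|D|)%N -> (0 < outdeg x)%N.
Proof.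
move=> sc D2; have /card_gt0P[y] : (0 < #|predC1 x|)%N.
  by rewrite cardC1 -ltnS prednK // ltnW.
rewrite !inE => yx; have /connectP[[|z p] /=] := sc x y.
  by move=> _ yE; rewrite yE eqxx in yx.
by move=> /andP[xz _] _; apply/card_gt0P; exists z; rewrite inE.
Qed.

Lemma outdeg_complete_digraph n (x : complete_digraph n) : outdeg x = n.-1.
Proof.
rewrite -[n in RHS]card_ord -(cardC1 x); apply: eq_card => y.
by rewrite !inE eq_sym.
Qed.

Lemma outdeg_dicycle n (x : dicycle n) : (1 < n)%N -> outdeg x = 1%N.
Proof.
move=> n2; rewrite -[RHS](card1 (ordS x)); apply: eq_card => y.
rewrite !inE /=; case: (y =P ordS x) => [->|_]; last by rewrite andbF.
(* [ordS] has no fixed point: at the wrap-around [x = 0] would force [n = 1], and elsewhere its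
   value is [x + 1]. *)
rewrite andbT; apply/eqP => /(congr1 val) /=.
have [/eqP xn|] := eqVneq x.+1 n.
  rewrite (eqP xn) modnn => x0; move: xn n2; rewrite x0 => /eqP <- //.
have := ltn_ord x; rewrite leq_eqVlt => /orP[/eqP -> /eqP//|lt _].
by rewrite modn_small // => /n_Sn.
Qed.

(** Without loops, outdegree [n - 1] means arcs to all other vertices, and then any bijection is an
    isomorphism. *)
Lemma complete_digraphP (D : digraph) n : #|D| = n ->
  digraph_iso D (complete_digraph n) <-> forall x : D, outdeg x = n.-1.
Proof.
move=> cD; split=> [[f [bf fa]] x|dn].
  by rewrite -(outdeg_iso bf fa) outdeg_complete_digraph.
have arcE (x y : D) : arc x y = (x != y).
  have : [set z : D | arc x z] = [set~ x].
    apply/eqP; rewrite eqEcard cardsC1 cD -(dn x) leqnn andbT.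
    apply/fintype.subsetP => z; rewrite !inE; apply: contraL => /eqP ->.
    by rewrite arc_irr.
  by move=> /setP/(_ y); rewrite !inE eq_sym.
exists (cast_ord cD \o enum_rank); split.
  apply: bij_comp; last exact: enum_rank_bij.
  by exists (cast_ord (esym cD)); [exact: cast_ordK|exact: cast_ordKV].
move=> x y /=; rewrite arcE.
by rewrite (inj_eq (@cast_ord_inj _ _ cD)) (inj_eq enum_rank_inj).
Qed.

(** Outdegree 1 makes the arcs the graph of a map [s], and strong connectivity makes all vertices a
    single orbit of [s]; numbering them by distance from a base vertex gives the cycle. *)
Lemma dicycleP (D : digraph) n :
  (1 < n)%N -> #|D| = n -> strongly_connected D ->
  digraph_iso D (dicycle n) <-> forall x : D, outdeg x = 1%N.
Proof.
move=> n2 cD sc; split=> [[f [bf fa]] x|d1].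
  by rewrite -(outdeg_iso bf fa) outdeg_dicycle.
have succ (x : D) : exists y, [set z : D | arc x z] == [set y].
  by have /eqP/cards1P[y E] := d1 x; exists y; apply/eqP.
pose s x := xchoose (succ x).
have arcE x y : arc x y = (y == s x).
  by have /eqP/setP/(_ y) := xchooseP (succ x); rewrite !inE.
have con x y : fconnect s x y.
  by rewrite (@eq_connect _ _ (@arc D)) // => a b; rewrite arcE /= eq_sym.
have ordE x : order s x = n.
  by rewrite -cD; apply: eq_card => y; rewrite !inE; exact: con.
have /card_gt0P[x0 _] : (0 < #|D|)%N by rewrite cD ltnW.
(* [x0] is reachable from [s x0], so its orbit closes after [n] steps. *)
have s_loop : iter n s x0 = x0.
  by rewrite -{1}(ordE x0); apply/(orbitPcycle 2 4); exact: con.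
have lt_n x : (findex s x0 x < n)%N by rewrite -(ordE x0) findex_max.
pose f (x : D) := Ordinal (lt_n x).
pose g (i : 'I_n) := iter i s x0.
have fK : cancel f g by move=> x; rewrite /g /= iter_findex.
have bf : bijective f.
  by apply: (inj_card_bij (can_inj fK)); rewrite card_ord cD.
have gK : cancel g f by apply/(bij_can_sym bf).
have fs x : f (s x) = ordS (f x).
  apply: (can_inj gK); rewrite fK /g /=.
  have [E|ne] := eqVneq (findex s x0 x).+1 n.
    (* At the last vertex of the orbit [s] returns to [x0], as [ordS] returns to 0. *)
    by rewrite E modnn /= -s_loop -E /= iter_findex.
  rewrite modn_small; last by rewrite ltn_neqAle ne lt_n.
  by rewrite /= iter_findex.
exists f; split=> // x y /=; rewrite -fs !(inj_eq (bij_inj bf)) -arcE.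
by case: (eqVneq x y) => //= <-; rewrite arc_irr.
Qed.

Theorem corollary2p6 (R : realType) (n : nat) (D : digraph)
    (n_ge2 : (2 <= n)%N) (card_D : #|D| = n) (sc_D : strongly_connected D) :
  [/\ 2 <= q R D <= 2 * (n%:R - 1),
      q R D = 2 * n%:R - 2 <-> digraph_iso D (complete_digraph n) &
      q R D = 2 <-> digraph_iso D (dicycle n)].
Proof.
have D_gt1 : (1 < #|D|)%N by rewrite card_D.
have /card_gt0P[x0 _] : (0 < #|D|)%N by exact: ltnW.
have lo := q_ge R sc_D x0 (fun x => outdeg_gt0 x sc_D D_gt1).
have up := q_le R sc_D x0 (@outdeg_leq_pred D).
(* The truncated predecessor becomes a ring subtraction because [n >= 1]. *)
rewrite card_D -subn1 natrB ?(ltnW n_ge2) // in up.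
have outdegP d : reflect (forall x : D, outdeg x = d)
    [forall (x : D | true), outdeg x == d].
  by apply: (iffP forallP) => d_x x; apply/eqP; exact: d_x.
rewrite mulr1 in lo; split.
- by rewrite lo up.
- rewrite (complete_digraphP card_D) -subn1 -[X in _ - X]mulr1 -mulrBr.
  by split=> [/eqP|/outdegP]; [rewrite up.2 => /outdegP|rewrite -up.2 => /eqP].
- rewrite (dicycleP n_ge2 card_D sc_D).
  split=> [/esym/eqP|/outdegP]; first by rewrite lo.2 => /outdegP.
  by rewrite -lo.2 => /eqP.
Qed.
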